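(* Let $G=(V,E)$ be a locally finite graph, let $S\subset V$ be a finite subset whose induced subgraph $G(S)$ is connected, let $\delta S$ be its boundary, assumed nonempty, and let $\bar S=S\cup\delta S$. Let $f,g:\bar S\to\mathbb{R}$ both satisfy the Dirichlet boundary condition, i.e. $f=g=0$ on $\delta S$. Consider the wave equation $$u_{tt}(x,t)=\Delta u(x,t),\qquad x\in S,\ t>0,$$ for $u:\bar S\times[0,\infty)\to\mathbb{R}$ with the Dirichlet boundary condition $u(x,t)=0$ for $x\in\delta S$, $t\ge 0$, and the initial conditions $u(x,0)=f(x)$ and $u_t(x,0)=g(x)$ for $x\in S$. Then the solution is given by $$u(x,t)=\sum_j\Big[f_j\cos(\sqrt{\lambda_j}\,t)+g_j\frac{\sin(\sqrt{\lambda_j}\,t)}{\sqrt{\lambda_j}}\Big]\phi_j(x),$$ where $f_j=\sum_{y\in\bar S}f(y)\phi_j(y)$ and $g_j=\sum_{y\in\bar S}g(y)\phi_j(y)$. Furthermore, for all $t\ge 0$, $$\int_{\bar S}\big[|\nabla u(t)|^2+u_t(t)^2\big]=\int_{\bar S}\big[|\nabla f|^2+g^2\big].$$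
   Context: A graph $G=(V,E)$ consists of a vertex set $V$ and an edge set $E$, each edge being an unordered pair of distinct vertices; $x\sim y$ means that there is an edge between $x$ and $y$. $G$ is locally finite in the sense that there is a constant $c>0$ with $\deg(x)=\#\{y\in V: y\sim x\}\le c$ for all $x\in V$. For a finite $S\subset V$, the induced subgraph $G(S)$ has vertex set $S$ and all edges $x\sim y$ with $x,y\in S$. The boundary $\delta S$ is the set of vertices not in $S$ that are adjacent to some vertex in $S$; $\bar S=S\cup\delta S$. For $h:\bar S\to\mathbb{R}$, the Laplacian is $(\Delta h)(x)=\sum_{y:\,y\sim x}(h(y)-h(x))$ for $x\in S$ (all neighbours of $x\in S$ lie in $\bar S$). Moreover $\int_{\bar S}h=\sum_{x\in\bar S}h(x)$, and $\int_{\bar S}|\nabla h|^2=\sum_{\{x,y\}\subset\bar S,\ x\sim y}|h(x)-h(y)|^2$, the sum being over unordered pairs of adjacent vertices of $\bar S$ (each edge counted once). The $\lambda_j>0$ and $\phi_j$ are the finitely many Dirichlet eigenvalues of $-\Delta$ on $S$ and corresponding real-valued eigenfunctions $\phi_j:\bar S\to\mathbb{R}$: $-\Delta\phi_j=\lambda_j\phi_j$ in $S$, $\phi_j=0$ on $\delta S$, $\sum_{x\in\bar S}|\phi_j(x)|^2=1$, chosen so that $\{\phi_j\}$ is an orthonormal basis (with respect to the inner product $\sum_{x\in\bar S}f(x)g(x)$) of the space of real functions on $\bar S$ vanishing on $\delta S$. A solution is understood to be twice differentiable in $t$ for $t>0$, with $u$ and $u_t$ continuous on $[0,\infty)$. 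*)

(* Defs.v *)
From mathcomp Require Import all_boot all_order all_algebra finmap.
From mathcomp Require Import all_classical all_reals all_analysis.

Set Implicit Arguments.
Unset Strict Implicit.
Unset Printing Implicit Defensive.

Import Order.TTheory GRing.Theory Num.Theory.
Import numFieldNormedType.Exports.
Local Open Scope ring_scope.
Local Open Scope classical_set_scope.

(** A simple graph is a symmetric irreflexive relation [adj] on a possibly
    infinite vertex type [V].  Real functions on the closure of a finite vertex
    set [S] are represented by functions [V -> R]; their
    values off the closure play no role, as [laplacian] is only evaluated on
    [S], whose neighbours all lie in the closure.  The sums [\sum_(x \in A) F x] are over
    classical sets, finite whenever [S] is finite and [adj] locally finite. *)

Definition locally_finite (V : choiceType) (adj : rel V) : Prop :=
  exists2 c : nat, (0 < c)%N & forall x, ([set y | adj x y] #<= `I_c)%card.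

Definition induced_rel (V : choiceType) (adj : rel V) (S : {fset V}) : rel S :=
  fun x y => adj (val x) (val y).

Definition induced_connected (V : choiceType) (adj : rel V) (S : {fset V}) :
    Prop :=
  forall x y : S, connect (induced_rel adj (S := S)) x y.

Definition boundary (V : choiceType) (adj : rel V) (S : {fset V}) : set V :=
  [set x | x \notin S /\ exists2 y, y \in S & adj y x].

Definition vclosure (V : choiceType) (adj : rel V) (S : {fset V}) : set V :=
  [set` S] `|` boundary adj S.

Definition laplacian (R : realType) (V : choiceType) (adj : rel V)
    (h : V -> R) (x : V) : R :=
  \sum_(y \in [set y | adj x y]) (h y - h x).

Definition vinner (R : realType) (V : choiceType) (adj : rel V) (S : {fset V})
    (f g : V -> R) : R :=
  \sum_(x \in vclosure adj S) f x * g x.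

(** The sum runs over ordered pairs, in which every edge of the closure occurs
    exactly twice; the factor 1/2 makes it count once. *)
Definition dirichlet_energy (R : realType) (V : choiceType) (adj : rel V)
    (S : {fset V}) (h : V -> R) : R :=
  2^-1 * \sum_(p \in [set p : V * V | [/\ vclosure adj S p.1,
                                         vclosure adj S p.2 & adj p.1 p.2]])
            `|h p.1 - h p.2| ^+ 2.

Definition vanishes_on_boundary (R : realType) (V : choiceType) (adj : rel V)
    (S : {fset V}) (h : V -> R) : Prop :=
  forall x, boundary adj S x -> h x = 0.

Record dirichlet_eigenbasis (R : realType) (V : choiceType) (adj : rel V)
    (S : {fset V}) (n : nat) (lam : 'I_n -> R) (phi : 'I_n -> V -> R) :
    Prop := DirichletEigenbasis {
  eigen_eq : forall j x, x \in S ->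
    - laplacian adj (phi j) x = lam j * phi j x ;
  eigen_bc : forall j, vanishes_on_boundary adj S (phi j) ;
  eigen_orthonormal : forall i j,
    vinner adj S (phi i) (phi j) = (i == j)%:R ;
  eigen_span : forall h : V -> R, vanishes_on_boundary adj S h ->
    exists a : 'I_n -> R, forall x, vclosure adj S x ->
      h x = \sum_(j < n) a j * phi j x }.

(** Time derivative of a function on [0, +oo[: two-sided for [0 < t], the right
    derivative at [t = 0].  The values of [h] at negative times play no role,
    and the value of [time_deriv h] there is irrelevant. *)
Definition time_deriv (R : realType) (h : R -> R) (t : R) : R :=
  if 0 < t then h^`() t
  else lim ((h s - h 0) / s @[s --> (0 : R)^'+]).

(** At [0 < t] the functions [time_deriv (u x)] and [(u x)^`()] agree in a
    neighbourhood of [t], so [(u x)^`(2) t] is the second time derivative. *)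
Record wave_solution (R : realType) (V : choiceType) (adj : rel V)
    (S : {fset V}) (f g : V -> R) (u : V -> R -> R) : Prop := WaveSolution {
  wave_derivable : forall x t, vclosure adj S x -> 0 < t ->
    derivable (u x) t 1 ;
  wave_derivable2 : forall x t, vclosure adj S x -> 0 < t ->
    derivable (u x)^`() t 1 ;
  wave_derivable0 : forall x, vclosure adj S x ->
    cvg ((u x s - u x 0) / s @[s --> (0 : R)^'+]) ;
  wave_continuous : forall x, vclosure adj S x ->
    {within `[(0 : R), +oo[, continuous (u x)} ;
  wave_continuous_deriv : forall x, vclosure adj S x ->
    {within `[(0 : R), +oo[, continuous (time_deriv (u x))} ;
  wave_eq : forall x t, x \in S -> 0 < t ->
    (u x)^`(2) t = laplacian adj (u ^~ t) x ;
  wave_bc : forall t, 0 <= t -> vanishes_on_boundary adj S (u ^~ t) ;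
  wave_init : forall x, x \in S -> u x 0 = f x ;
  wave_init_deriv : forall x, x \in S -> time_deriv (u x) 0 = g x }.

(* Main.v *)
Require Import Defs.
From mathcomp Require Import all_boot all_order all_algebra finmap.
From mathcomp Require Import all_classical all_reals all_analysis.
From mathcomp Require Import ring.

Set Implicit Arguments.
Unset Strict Implicit.
Unset Printing Implicit Defensive.

Import Order.TTheory GRing.Theory Num.Theory.
Import numFieldNormedType.Exports.
Local Open Scope ring_scope.
Local Open Scope classical_set_scope.

(** Expanding in the eigenbasis turns the wave equation into uncoupled harmonic
    oscillators. Green's formula [green_formula] writes the Dirichlet form as
    minus the inner product with the Laplacian for functions vanishing on the
    boundary. Since that form is symmetric, so is the Laplacian, and the
    coefficients [c j t] of a solution on [phi j] satisfy [c'' = - lam j * c]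
    on the open half-line. Since it is also nonnegative, and on a connected [S]
    with nonempty boundary only the zero function has zero energy, every
    [lam j] is positive ([eigenvalue_gt0]); hence [sqrt (lam j)] is a genuine
    frequency and may be divided by.

    The oscillator with frequency [w] and initial data [a], [b] has a unique
    solution on the closed half-line ([oscillator_uniqueness]): rotating the
    phase vector [(c, c' / w)] back by the angle [w * t] gives a vector with
    zero derivative on the open half-line, which by continuity keeps its value
    at [0]. This is where the continuity of [u] and of its time derivative up
    to [t = 0] enters. Applied to every coefficient, it gives the
    formula ([wave_coefficients]); conversely the formula is differentiated
    term by term ([superposition_wave_solution]).

    In the eigenbasis the energy of a solution is the sum over [j] of
    [lam j * c j ^+ 2 + c' j ^+ 2] ([dirichlet_energy_spectral], [parseval]),
    and each summand is the constant energy of one oscillator, because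
    [cos ^+ 2 + sin ^+ 2 = 1]. *)

(** * Finite sums over the closure of the vertex set *)

Lemma locally_finite_neighbors (V : choiceType) (adj : rel V) (x : V) :
  locally_finite adj -> finite_set [set y | adj x y].
Proof.
by case=> c _ /(_ x) nbx; apply: (card_le_finite nbx); exact: finite_II.
Qed.

Lemma finite_vclosure (V : choiceType) (adj : rel V) (S : {fset V}) :
  locally_finite adj -> finite_set (vclosure adj S).
Proof.
move=> lf; rewrite /vclosure finite_setU; split; first exact: finite_fset.
apply: (@sub_finite_set _ _ (\bigcup_(y in [set` S]) [set x | adj y x])).
  by move=> x [_ [y yS yx]]; exists y.
apply: bigcup_finite; first exact: finite_fset.
by move=> y _; exact: locally_finite_neighbors.
Qed.

(** Listing the closure as a finite set replaces the sums over classical sets by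
    ordinary iterated sums, which can be exchanged and reindexed. *)
Definition closure_fset (V : choiceType) (adj : rel V) (S : {fset V}) :
  {fset V} := fset_set (vclosure adj S).

Lemma in_closure_fset (V : choiceType) (adj : rel V) (S : {fset V}) (x : V) :
  locally_finite adj -> x \in closure_fset adj S <-> vclosure adj S x.
Proof.
move=> lf; rewrite /closure_fset in_fset_set; last exact: finite_vclosure.
by rewrite inE.
Qed.

Lemma vclosure_interior (V : choiceType) (adj : rel V) (S : {fset V}) (x : V) :
  x \in S -> vclosure adj S x.
Proof. by left. Qed.

Lemma vclosure_neighbor (V : choiceType) (adj : rel V) (S : {fset V})
    (x y : V) : x \in S -> adj x y -> vclosure adj S y.
Proof.
move=> xS xy; case: (boolP (y \in S)) => yS; first by left.
by right; split=> //; exists x.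
Qed.

Lemma vclosure_sumE (R : realType) (V : choiceType) (adj : rel V)
    (S : {fset V}) (F : V -> R) : locally_finite adj ->
  \sum_(x \in vclosure adj S) F x = \sum_(x <- closure_fset adj S) F x.
Proof. by move=> lf; rewrite fsbig_finite//; exact: finite_vclosure. Qed.

(** All neighbours of an interior vertex lie in the closure, so the closure
    serves as one summation domain for every interior vertex. *)
Lemma laplacianE (R : realType) (V : choiceType) (adj : rel V) (S : {fset V})
    (h : V -> R) (x : V) : locally_finite adj -> x \in S ->
  laplacian adj h x = \sum_(y <- closure_fset adj S | adj x y) (h y - h x).
Proof.
move=> lf xS; rewrite /laplacian.
have -> : [set y | adj x y] = vclosure adj S `&` [set y | adj x y].
  by rewrite setIidr// => y /= xy; exact: vclosure_neighbor xy.
rewrite fsbig_mkcondr vclosure_sumE// [RHS]big_mkcond /=.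
by apply: eq_bigr => y _; rewrite /patch mem_setE.
Qed.

(** * Green's formula and the Dirichlet form *)

(** Polarization of the energy. The sum counts every edge in both directions,
    which the factor [2^-1] compensates. *)
Definition dirichlet_form (R : realType) (V : choiceType) (adj : rel V)
    (S : {fset V}) (h k : V -> R) : R :=
  2^-1 * \sum_(x <- closure_fset adj S) \sum_(y <- closure_fset adj S | adj x y)
            (h x - h y) * (k x - k y).

Lemma dirichlet_energyE (R : realType) (V : choiceType) (adj : rel V)
    (S : {fset V}) (h : V -> R) : locally_finite adj ->
  dirichlet_energy adj S h = dirichlet_form adj S h h.
Proof.
move=> lf; rewrite /dirichlet_energy /dirichlet_form; congr (_ * _).
have -> : [set p : V * V | [/\ vclosure adj S p.1, vclosure adj S p.2
      & adj p.1 p.2]]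
    = (vclosure adj S `*` vclosure adj S) `&` [set p | adj p.1 p.2].
  by apply/seteqP; split=> [[x y]/= [? ? ?]|[x y]/= [[? ?] ?]].
rewrite fsbig_mkcondr.
pose F x y := if adj x y then (h x - h y) * (h x - h y) else 0.
transitivity (\sum_(p \in vclosure adj S `*` vclosure adj S) F p.1 p.2).
  apply: eq_fsbigr => p _; rewrite /patch mem_setE unfold_in /= /F.
  by case: ifP => // _; rewrite real_normK ?num_real// expr2.
rewrite -(pair_fsbig _ F); [|exact: finite_vclosure..].
rewrite vclosure_sumE//; apply: eq_bigr => x _.
by rewrite vclosure_sumE// [RHS]big_mkcond.
Qed.

Lemma vinnerE (R : realType) (V : choiceType) (adj : rel V) (S : {fset V})
    (h k : V -> R) : locally_finite adj ->
  vinner adj S h k = \sum_(x <- closure_fset adj S) h x * k x.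
Proof. by move=> lf; rewrite /vinner vclosure_sumE. Qed.

(** Against a function vanishing on the boundary, the inner product sees only
    the values on [S]; this is how identities known only on [S], such as the
    wave equation and the initial conditions, pass to coefficients. *)
Lemma eq_vinner_vanishing (R : realType) (V : choiceType) (adj : rel V)
    (S : {fset V}) (h h' k : V -> R) : locally_finite adj ->
  vanishes_on_boundary adj S k -> (forall x, x \in S -> h x = h' x) ->
  vinner adj S h k = vinner adj S h' k.
Proof.
move=> lf k0 hh'; rewrite !vinnerE//; apply: eq_big_seq => x.
by move=> /(in_closure_fset _ _ lf)[/hh'->|/k0->]//; rewrite !mulr0.
Qed.

Lemma vinnerC (R : realType) (V : choiceType) (adj : rel V) (S : {fset V})
    (h k : V -> R) : vinner adj S h k = vinner adj S k h.
Proof. by apply: eq_fsbigr => x _; rewrite mulrC. Qed.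

(** Summation by parts: exchanging the ends of each edge shows that [k x] and
    [- k y] contribute equally, which cancels the factor [2^-1]; the boundary
    terms of what remains are killed by [k]. *)
Lemma green_formula (R : realType) (V : choiceType) (adj : rel V)
    (S : {fset V}) (h k : V -> R) :
  symmetric adj -> locally_finite adj -> vanishes_on_boundary adj S k ->
  dirichlet_form adj S h k = - vinner adj S (laplacian adj h) k.
Proof.
move=> adjC lf k0; rewrite /dirichlet_form vinnerE//.
set C := closure_fset adj S.
pose T := \sum_(x <- C) \sum_(y <- C | adj x y) (h x - h y) * k x.
(* Relabel each oriented edge by its reverse. *)
have TE : T = \sum_(x <- C) \sum_(y <- C | adj x y) (h y - h x) * k y.
  rewrite /T (exchange_big_dep xpredT)//=; apply: eq_bigr => x _.
  by apply: eq_bigl => y; rewrite adjC.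
have -> : \sum_(x <- C) \sum_(y <- C | adj x y) (h x - h y) * (k x - k y)
    = T + T.
  rewrite {2}TE /T -big_split /=; apply: eq_bigr => x _.
  by rewrite -big_split /=; apply: eq_bigr => y _; ring.
rewrite (_ : 2^-1 * _ = T); last by field.
rewrite /T -sumrN; apply: eq_big_seq => x.
move=> /(in_closure_fset _ _ lf)[xS|/k0 kx0]; last first.
  by rewrite kx0 mulr0 oppr0; apply: big1 => y _; rewrite mulr0.
rewrite (@laplacianE _ _ _ S)// -mulNr -sumrN mulr_suml.
by apply: eq_bigr => y _; rewrite opprB.
Qed.

Lemma dirichlet_formC (R : realType) (V : choiceType) (adj : rel V)
    (S : {fset V}) (h k : V -> R) :
  dirichlet_form adj S h k = dirichlet_form adj S k h.
Proof.
congr (_ * _); apply: eq_bigr => x _; apply: eq_bigr => y _; exact: mulrC.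
Qed.

Lemma laplacian_selfadjoint (R : realType) (V : choiceType) (adj : rel V)
    (S : {fset V}) (h k : V -> R) : symmetric adj -> locally_finite adj ->
  vanishes_on_boundary adj S h -> vanishes_on_boundary adj S k ->
  vinner adj S (laplacian adj h) k = vinner adj S h (laplacian adj k).
Proof.
move=> adjC lf h0 k0; apply: oppr_inj.
by rewrite -green_formula// dirichlet_formC green_formula// vinnerC.
Qed.

Lemma eq_laplacian (R : realType) (V : choiceType) (adj : rel V)
    (S : {fset V}) (h k : V -> R) (x : V) :
  (forall y, vclosure adj S y -> h y = k y) -> x \in S ->
  laplacian adj h x = laplacian adj k x.
Proof.
move=> hk xS; apply: eq_fsbigr => y /set_mem /= xy.
by rewrite !hk//; [exact: vclosure_interior|exact: vclosure_neighbor xy].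
Qed.

Lemma laplacian_sum (R : realType) (V : choiceType) (adj : rel V)
    (n : nat) (c : 'I_n -> R) (k : 'I_n -> V -> R) (x : V) :
  locally_finite adj ->
  laplacian adj (fun y => \sum_(j < n) c j * k j y) x =
  \sum_(j < n) c j * laplacian adj (k j) x.
Proof.
move=> lf; have nbx := locally_finite_neighbors x lf.
rewrite /laplacian fsbig_finite//.
under [RHS]eq_bigr do rewrite fsbig_finite// mulr_sumr.
rewrite exchange_big /=; apply: eq_bigr => y _.
by rewrite -sumrB; apply: eq_bigr => j _; rewrite mulrBr.
Qed.

Lemma dirichlet_form_ge0 (R : realType) (V : choiceType) (adj : rel V)
    (S : {fset V}) (h : V -> R) : 0 <= dirichlet_form adj S h h.
Proof.
apply: mulr_ge0; first by rewrite invr_ge0.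
by apply: sumr_ge0 => x _; apply: sumr_ge0 => y _; rewrite -expr2 sqr_ge0.
Qed.

Lemma dirichlet_form_eq0_edge (R : realType) (V : choiceType) (adj : rel V)
    (S : {fset V}) (h : V -> R) (x y : V) : locally_finite adj ->
  dirichlet_form adj S h h = 0 -> vclosure adj S x -> vclosure adj S y ->
  adj x y -> h x = h y.
Proof.
move=> lf /eqP; rewrite /dirichlet_form mulf_eq0 invr_eq0 pnatr_eq0 /=.
move=> D0 /(in_closure_fset _ _ lf) xC /(in_closure_fset _ _ lf) yC xy.
have sq_ge0 (z w : V) : 0 <= (h z - h w) * (h z - h w).
  by rewrite -expr2 sqr_ge0.
have := D0; rewrite psumr_eq0; last by move=> z _; exact: sumr_ge0.
move=> /allP/(_ x xC)/=; rewrite psumr_eq0//.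
by move=> /allP/(_ y yC)/=; rewrite xy/= mulf_eq0 orbb subr_eq0 => /eqP.
Qed.

(** Zero energy forces [h] to be constant along paths in [S], and an edge links
    [S] to a boundary vertex, where [h] is zero. *)
Lemma dirichlet_form_definite (R : realType) (V : choiceType) (adj : rel V)
    (S : {fset V}) (h : V -> R) : locally_finite adj ->
  induced_connected adj S -> boundary adj S !=set0 ->
  vanishes_on_boundary adj S h -> dirichlet_form adj S h h = 0 ->
  forall x, vclosure adj S x -> h x = 0.
Proof.
move=> lf conn [z dz] h0 D0; case: (dz) => zS [y yS yz].
have hy0 : h y = 0.
  rewrite -(h0 z dz); apply: (dirichlet_form_eq0_edge lf D0) => //.
    exact: vclosure_interior.
  by right.
move=> x [xS|/h0//]; rewrite -hy0.
have path_const p (a : S) : path (induced_rel adj (S := S)) a p ->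
    h (val (last a p)) = h (val a).
  elim: p a => //= b p IH a /andP[ab /IH ->]; apply/esym.
  by apply: (dirichlet_form_eq0_edge lf D0) ab; exact/vclosure_interior/valP.
have /connectP[p py] := conn [` yS]%fset [` xS]%fset.
by move=> /(congr1 val)/= ->; rewrite path_const.
Qed.

(** * Spectral decomposition *)

Lemma vinner_suml (R : realType) (V : choiceType) (adj : rel V)
    (S : {fset V}) (n : nat) (c : 'I_n -> R) (k : 'I_n -> V -> R)
    (h h' : V -> R) : locally_finite adj ->
  (forall x, vclosure adj S x -> h x = \sum_(j < n) c j * k j x) ->
  vinner adj S h h' = \sum_(j < n) c j * vinner adj S (k j) h'.
Proof.
move=> lf hE; rewrite vinnerE//.
under [RHS]eq_bigr do rewrite vinnerE// mulr_sumr.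
rewrite exchange_big /=; apply: eq_big_seq => x /(in_closure_fset _ _ lf) xC.
by rewrite hE// mulr_suml; apply: eq_bigr => j _; rewrite mulrA.
Qed.

Lemma eigenbasis_coef (R : realType) (V : choiceType) (adj : rel V)
    (S : {fset V}) (n : nat) (lam : 'I_n -> R) (phi : 'I_n -> V -> R)
    (c : 'I_n -> R) (h : V -> R) (i : 'I_n) :
  locally_finite adj -> dirichlet_eigenbasis adj S lam phi ->
  (forall x, vclosure adj S x -> h x = \sum_(j < n) c j * phi j x) ->
  vinner adj S h (phi i) = c i.
Proof.
move=> lf [_ _ ortho _] hE; rewrite (vinner_suml _ lf hE) (bigD1 i)//=.
rewrite ortho eqxx mulr1 big1 ?addr0// => j ji.
by rewrite ortho (negbTE ji) mulr0.
Qed.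

Lemma eigenbasis_expansion (R : realType) (V : choiceType) (adj : rel V)
    (S : {fset V}) (n : nat) (lam : 'I_n -> R) (phi : 'I_n -> V -> R)
    (h : V -> R) (x : V) :
  locally_finite adj -> dirichlet_eigenbasis adj S lam phi ->
  vanishes_on_boundary adj S h -> vclosure adj S x ->
  h x = \sum_(j < n) vinner adj S h (phi j) * phi j x.
Proof.
move=> lf basis h0 xC; have [c hE] := eigen_span basis h0.
rewrite hE//; apply: eq_bigr => j _.
by rewrite (eigenbasis_coef _ lf basis hE).
Qed.

Lemma parseval (R : realType) (V : choiceType) (adj : rel V)
    (S : {fset V}) (n : nat) (lam : 'I_n -> R) (phi : 'I_n -> V -> R)
    (h : V -> R) :
  locally_finite adj -> dirichlet_eigenbasis adj S lam phi ->
  vanishes_on_boundary adj S h ->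
  \sum_(x \in vclosure adj S) h x ^+ 2 =
  \sum_(j < n) vinner adj S h (phi j) ^+ 2.
Proof.
move=> lf basis h0; transitivity (vinner adj S h h).
  by apply: eq_fsbigr => x _; rewrite expr2.
rewrite (vinner_suml _ lf (fun x => eigenbasis_expansion lf basis h0)).
by apply: eq_bigr => j _; rewrite vinnerC expr2.
Qed.

(** Self-adjointness moves the Laplacian from [h] onto [phi j], so passing to
    coefficients diagonalizes it. *)
Lemma vinner_laplacian_eigen (R : realType) (V : choiceType) (adj : rel V)
    (S : {fset V}) (n : nat) (lam : 'I_n -> R) (phi : 'I_n -> V -> R)
    (h : V -> R) (j : 'I_n) : symmetric adj ->
  locally_finite adj -> dirichlet_eigenbasis adj S lam phi ->
  vanishes_on_boundary adj S h ->
  vinner adj S (laplacian adj h) (phi j) = - (lam j * vinner adj S h (phi j)).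
Proof.
move=> adjC lf basis h0.
rewrite (laplacian_selfadjoint adjC lf h0 (eigen_bc basis j)) vinnerC.
rewrite (eq_vinner_vanishing lf h0 (h' := fun x => - lam j * phi j x)).
  rewrite [in RHS]vinnerC !vinnerE// mulr_sumr -sumrN.
  by apply: eq_bigr => x _; rewrite !mulNr mulrA.
by move=> x xS; rewrite mulNr -(eigen_eq basis)// opprK.
Qed.

Lemma dirichlet_energy_spectral (R : realType) (V : choiceType) (adj : rel V)
    (S : {fset V}) (n : nat) (lam : 'I_n -> R) (phi : 'I_n -> V -> R)
    (h : V -> R) : symmetric adj ->
  locally_finite adj -> dirichlet_eigenbasis adj S lam phi ->
  vanishes_on_boundary adj S h ->
  dirichlet_energy adj S h =
  \sum_(j < n) lam j * vinner adj S h (phi j) ^+ 2.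
Proof.
move=> adjC lf basis h0; rewrite dirichlet_energyE// green_formula// vinnerC.
rewrite (vinner_suml _ lf (fun x => eigenbasis_expansion lf basis h0)) -sumrN.
apply: eq_bigr => j _; rewrite [vinner _ _ (phi j) _]vinnerC.
by rewrite (vinner_laplacian_eigen _ adjC lf basis h0); ring.
Qed.

(** A normalized eigenfunction has energy [lam j]; were it zero, the
    eigenfunction would vanish on the whole closure and could not have norm
    one. *)
Lemma eigenvalue_gt0 (R : realType) (V : choiceType) (adj : rel V)
    (S : {fset V}) (n : nat) (lam : 'I_n -> R) (phi : 'I_n -> V -> R)
    (j : 'I_n) : symmetric adj -> locally_finite adj ->
  induced_connected adj S -> boundary adj S !=set0 ->
  dirichlet_eigenbasis adj S lam phi -> 0 < lam j.
Proof.
move=> adjC lf conn dS basis; have bc := eigen_bc basis j.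
have phi1 := eigen_orthonormal basis j j; rewrite eqxx in phi1.
have lamE : dirichlet_form adj S (phi j) (phi j) = lam j.
  rewrite green_formula// (vinner_laplacian_eigen _ adjC lf basis bc).
  by rewrite phi1 mulr1 opprK.
rewrite lt_neqAle -{2}lamE dirichlet_form_ge0 andbT; apply/eqP => lam0.
have phi0 := dirichlet_form_definite lf conn dS bc (etrans lamE (esym lam0)).
have := oner_neq0 R; rewrite -[1]/(true%:R) -phi1 /vinner fsbig1 ?eqxx//.
by move=> x /phi0 ->; rewrite mul0r.
Qed.

(** * Calculus on the half-line *)

Lemma is_derive1_derive1 (R : realType) (h : R -> R) (t dh : R) :
  is_derive t 1 h dh -> h^`() t = dh.
Proof. by case=> _ <-; rewrite derive1E. Qed.

Lemma is_derive_big_sum (R : realType) (T : eqType) (s : seq T)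
    (h : T -> R -> R) (dh : T -> R) (t : R) :
  (forall x, x \in s -> is_derive t 1 (h x) (dh x)) ->
  is_derive t 1 (fun r => \sum_(x <- s) h x r) (\sum_(x <- s) dh x).
Proof.
elim: s => [|x s IH] hd.
  rewrite big_nil (_ : (fun _ => _) = cst 0); first exact: is_derive_cst.
  by apply/funext => r; rewrite big_nil.
rewrite big_cons (_ : (fun _ => _) = h x + (fun r => \sum_(y <- s) h y r)).
  apply: is_deriveD; first by apply: hd; rewrite mem_head.
  by apply: IH => y ys; apply: hd; rewrite inE ys orbT.
by apply/funext => r; rewrite big_cons.
Qed.

Lemma is_deriveMr (R : realType) (h : R -> R) (t dh c : R) :
  is_derive t 1 h dh -> is_derive t 1 (fun r => h r * c) (dh * c).
Proof.
move=> hd; have hc := is_deriveM hd (is_derive_cst c t 1).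
by apply: is_derive_eq hc _; rewrite scaler0 add0r; exact: mulrC.
Qed.

Lemma within_continuous_big_sum (R : realType) (T : eqType) (s : seq T)
    (h : T -> R -> R) (A : set R) :
  (forall x, x \in s -> {within A, continuous (h x)}) ->
  {within A, continuous (fun r => \sum_(x <- s) h x r)}.
Proof.
elim: s => [|x s IH] hc.
  rewrite (_ : (fun _ => _) = cst 0); last by apply/funext=> r; rewrite big_nil.
  by apply: continuous_subspaceT => r; exact: cvg_cst.
rewrite (_ : (fun _ => _) = h x + (fun r => \sum_(y <- s) h y r)).
  apply: within_continuousD; first by apply: hc; rewrite mem_head.
  by apply: IH => y ys; apply: hc; rewrite inE ys orbT.
by apply/funext => r; rewrite big_cons.
Qed.

Lemma within_continuousM (R : realType) (h k : R -> R) (A : set R) :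
  {within A, continuous h} -> {within A, continuous k} ->
  {within A, continuous (h * k)}.
Proof.
move=> /subspace_continuousP hc /subspace_continuousP kc.
by apply/subspace_continuousP => t At; apply: cvgM; [exact: hc|exact: kc].
Qed.

Lemma is_derive_continuous (R : realType) (h dh : R -> R) :
  (forall t : R, is_derive t 1 h (dh t)) -> continuous h.
Proof.
by move=> hd t; apply/differentiable_continuous/derivable1_diffP; case: (hd t).
Qed.

(** The mean value theorem asks for the derivative inside the interval and for
    continuity at its ends, which matches the regularity of a solution: the
    equation holds at positive times and the data are attained as limits. *)
Lemma constant_half_line (R : realType) (h : R -> R) :
  {within `[(0 : R), +oo[, continuous h} ->
  (forall t : R, 0 < t -> is_derive t 1 h 0) ->
  forall t, 0 <= t -> h t = h 0.
Proof.
move=> hc hd t t0.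
have [||c _] := @MVT_segment R h (fun=> 0) 0 t t0.
- by move=> s; rewrite in_itv/= => /andP[/hd].
- apply: continuous_subspaceW hc => s /=.
  by rewrite !in_itv/= andbT => /andP[].
by rewrite mul0r => /eqP; rewrite subr_eq0 => /eqP.
Qed.

Lemma time_deriv_gt0 (R : realType) (h : R -> R) (t : R) :
  0 < t -> time_deriv h t = h^`() t.
Proof. by rewrite /time_deriv => ->. Qed.

Lemma near_eq_half_line (R : realType) (h k : R -> R) (t : R) :
  (forall s : R, 0 <= s -> h s = k s) -> 0 < t -> {near t, h =1 k}.
Proof.
move=> hk t0; near=> s; apply/hk/ltW; near: s; exact: lt_nbhsr.
Unshelve. all: by end_near. Qed.

(** At [0] only the values on the right matter, so the one-sided quotient can be
    read off from a function [k] that is differentiable across [0]. *)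
Lemma right_quotient_cvg (R : realType) (h k : R -> R) (dk : R) :
  (forall s, 0 <= s -> h s = k s) -> is_derive (0 : R) 1 k dk ->
  (h s - h 0) / s @[s --> (0 : R)^'+] --> dk.
Proof.
move=> hk [kd kE].
have kq : (k s - k 0) / s @[s --> (0 : R)^'+] --> dk.
  apply: cvg_dnbhs_at_right; rewrite -kE /derive.
  have := kd; rewrite /derivable.
  rewrite (_ : (fun s => _) = (fun s => (k s - k 0) / s))//.
  by apply/funext => s /=; rewrite addr0 [_%:A]mulr1; exact: mulrC.
apply: cvg_trans kq; apply: near_eq_cvg; near=> s.
by rewrite !hk// ltW//; near: s; exact: nbhs_right_gt.
Unshelve. all: by end_near. Qed.

Lemma time_deriv_eq (R : realType) (h k : R -> R) (t dk : R) :
  (forall s, 0 <= s -> h s = k s) -> is_derive t 1 k dk -> 0 <= t ->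
  time_deriv h t = dk.
Proof.
move=> hk kd; rewrite le_eqVlt => /predU1P[t0|t0].
  subst t; rewrite /time_deriv ltxx; apply: cvg_lim => //.
  exact: right_quotient_cvg kd.
rewrite time_deriv_gt0// derive1E (near_eq_derive _ (near_eq_half_line hk t0)).
by rewrite -derive1E; exact: is_derive1_derive1.
Qed.

(** * Harmonic oscillator *)

Lemma is_derive_comp_scale (R : realType) (h : R -> R) (w t dh : R) :
  is_derive (w * t) 1 h dh -> is_derive t 1 (fun r => h (w * r)) (w * dh).
Proof.
move=> hd; have wd : is_derive t 1 (fun r => w * r) w.
  have := is_deriveMr w (is_derive_id t (1 : R)); rewrite mul1r.
  by under eq_fun do rewrite mulrC.
have D := is_derive1_comp hd wd.
by apply: is_derive_eq D _; rewrite mulrC.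
Qed.

(** Position at time [t] of the oscillator of frequency [w] with initial
    position [a] and initial velocity [b]. *)
Definition oscillation (R : realType) (w a b t : R) : R :=
  a * cos (w * t) + b * (sin (w * t) / w).

Lemma oscillation0 (R : realType) (w a b : R) : oscillation w a b 0 = a.
Proof. by rewrite /oscillation mulr0 cos0 sin0 mul0r mulr0 mulr1 addr0. Qed.

(** The velocity of an oscillator is again an oscillator of the same frequency,
    with initial data given by the initial velocity [b] and the initial
    acceleration [- w ^+ 2 * a]. Differentiating twice therefore needs no new
    computation. *)
Lemma is_derive_oscillation (R : realType) (w a b t : R) : w != 0 ->
  is_derive t 1 (oscillation w a b) (oscillation w b (- (w ^+ 2 * a)) t).
Proof.
move=> w0.
have dc := is_deriveMr a (is_derive_comp_scale (is_derive_cos (w * t))).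
have ds := is_deriveMr (b / w) (is_derive_comp_scale (is_derive_sin (w * t))).
have := is_deriveD dc ds.
rewrite (_ : _ + _ = oscillation w a b); last first.
  by apply/funext => r; rewrite /oscillation /= !fctE; ring.
by move=> D; apply: is_derive_eq D _; rewrite /oscillation; field.
Qed.

Lemma oscillation_energy (R : realType) (w a b t : R) : w != 0 ->
  w ^+ 2 * oscillation w a b t ^+ 2
    + oscillation w b (- (w ^+ 2 * a)) t ^+ 2 = w ^+ 2 * a ^+ 2 + b ^+ 2.
Proof.
move=> w0; rewrite /oscillation.
rewrite -[RHS]mulr1 -(cos2Dsin2 (w * t)).
by field.
Qed.

(** Turning the phase vector [(c, d / w)] back to time [0] produces the constants
    of motion [A] and [B / w]; the values of [A] and [B] at [0] are the initial
    position and velocity, and turning forward again recovers [c] and [d]. *)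
Lemma oscillator_uniqueness (R : realType) (w : R) (c d : R -> R) :
  w != 0 ->
  {within `[(0 : R), +oo[, continuous c} ->
  {within `[(0 : R), +oo[, continuous d} ->
  (forall t : R, 0 < t -> is_derive t 1 c (d t)) ->
  (forall t : R, 0 < t -> is_derive t 1 d (- (w ^+ 2 * c t))) ->
  forall t : R, 0 <= t -> c t = oscillation w (c 0) (d 0) t /\
    d t = oscillation w (d 0) (- (w ^+ 2 * c 0)) t.
Proof.
move=> w0 cc dc cd dd t t0.
pose C r := cos (w * r); pose N r := sin (w * r).
have Cd (r : R) : is_derive r 1 C (w * - N r).
  exact: is_derive_comp_scale (is_derive_cos (w * r)).
have Nd (r : R) : is_derive r 1 N (w * C r).
  exact: is_derive_comp_scale (is_derive_sin (w * r)).
have Cc : {within `[(0 : R), +oo[, continuous C}.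
  exact/continuous_subspaceT/(is_derive_continuous Cd).
have Nc : {within `[(0 : R), +oo[, continuous N}.
  exact/continuous_subspaceT/(is_derive_continuous Nd).
have Kc (x : R) : {within `[(0 : R), +oo[, continuous (cst x : R -> R)}.
  by apply: continuous_subspaceT => r; exact: cvg_cst.
pose A := c * C + d * N * cst (- w^-1).
pose B := c * N * cst w + d * C.
have Ac : {within `[(0 : R), +oo[, continuous A}.
  apply: within_continuousD; first exact: within_continuousM.
  by do 2!apply: within_continuousM => //.
have Bc : {within `[(0 : R), +oo[, continuous B}.
  apply: within_continuousD; last exact: within_continuousM.
  by do 2!apply: within_continuousM => //.
have Ad (r : R) : 0 < r -> is_derive r 1 A 0.
  move=> r0; have cr := cd r r0; have dr := dd r r0.
  have D := is_deriveD (is_deriveM cr (Cd r))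
    (is_deriveM (is_deriveM dr (Nd r)) (is_derive_cst (- w^-1) r 1)).
  by apply: is_derive_eq D _; rewrite !fctE /GRing.scale /=; field.
have Bd (r : R) : 0 < r -> is_derive r 1 B 0.
  move=> r0; have cr := cd r r0; have dr := dd r r0.
  have D := is_deriveD (is_deriveM (is_deriveM cr (Nd r)) (is_derive_cst w r 1))
    (is_deriveM dr (Cd r)).
  by apply: is_derive_eq D _; rewrite !fctE /GRing.scale /=; ring.
have At := constant_half_line Ac Ad t0; have Bt := constant_half_line Bc Bd t0.
have A0 : A 0 = c 0.
  by rewrite /A /C /N !fctE mulr0 cos0 sin0 mulr1 mulr0 mul0r addr0.
have B0 : B 0 = d 0.
  by rewrite /B /C /N !fctE mulr0 cos0 sin0 mulr0 mul0r add0r mulr1.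
have cs := cos2Dsin2 (w * t).
(* Undoing the rotation: both identities hold up to the factor
   [cos ^+ 2 + sin ^+ 2]. *)
rewrite /oscillation -A0 -B0 -At -Bt /A /B /C /N !fctE.
split.
  rewrite -[LHS]mulr1 -cs; field. exact: w0.
by rewrite -[LHS]mulr1 -cs; field.
Qed.

(** * Solutions of the wave equation *)

Definition superposition (R : realType) (V : choiceType) (n : nat)
    (lam : 'I_n -> R) (phi : 'I_n -> V -> R) (a b : 'I_n -> R) (x : V)
    (t : R) : R :=
  \sum_(j < n) oscillation (Num.sqrt (lam j)) (a j) (b j) t * phi j x.

Lemma sqrtr_neq0 (R : realType) (l : R) : 0 < l -> Num.sqrt l != 0.
Proof. by move=> l0; rewrite gt_eqF// sqrtr_gt0. Qed.

Lemma is_derive_superposition (R : realType) (V : choiceType) (n : nat)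
    (lam : 'I_n -> R) (phi : 'I_n -> V -> R) (a b : 'I_n -> R) (x : V)
    (t : R) : (forall j, 0 < lam j) ->
  is_derive t 1 (superposition lam phi a b x)
    (superposition lam phi b (fun j => - (lam j * a j)) x t).
Proof.
move=> lam0; apply: is_derive_big_sum => j _; apply: is_deriveMr.
have := is_derive_oscillation (a j) (b j) t (sqrtr_neq0 (lam0 j)).
by rewrite sqr_sqrtr// ltW.
Qed.

(** The superposition is smooth on the whole line and [u] agrees with it for
    nonnegative times only, so derivatives are transferred to [u] near each
    positive time, and at [0] through the right difference quotient. *)
Lemma superposition_wave_solution (R : realType) (V : choiceType)
    (adj : rel V) (S : {fset V}) (n : nat) (lam : 'I_n -> R)
    (phi : 'I_n -> V -> R) (f g : V -> R) (u : V -> R -> R) :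
  locally_finite adj -> (forall j, 0 < lam j) ->
  dirichlet_eigenbasis adj S lam phi ->
  vanishes_on_boundary adj S f -> vanishes_on_boundary adj S g ->
  (forall x (t : R), vclosure adj S x -> 0 <= t ->
     u x t = superposition lam phi (fun j => vinner adj S f (phi j))
       (fun j => vinner adj S g (phi j)) x t) ->
  wave_solution adj S f g u.
Proof.
move=> lf lam0 basis f0 g0.
set a := fun j => vinner adj S f _; set b := fun j => vinner adj S g _ => uE.
pose a' j := - (lam j * a j).
have D0 x (t : R) := is_derive_superposition phi a b x t lam0.
have D1 x (t : R) := is_derive_superposition phi b a' x t lam0.
have u1 x (t : R) : vclosure adj S x -> 0 < t ->
    (u x)^`() t = superposition lam phi b a' x t.
  move=> xC t0; rewrite derive1E.
  rewrite (near_eq_derive _ (near_eq_half_line (uE x ^~ xC) t0)).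
  by rewrite -derive1E; exact: is_derive1_derive1.
have near_u1 x (t : R) : vclosure adj S x -> 0 < t ->
    {near t, superposition lam phi b a' x =1 (u x)^`()}.
  by move=> xC t0; near=> s; rewrite u1//; near: s; exact: lt_nbhsr.
have tdE x (t : R) : vclosure adj S x -> 0 <= t ->
    time_deriv (u x) t = superposition lam phi b a' x t.
  by move=> xC; apply: time_deriv_eq (D0 x t) => s; exact: uE.
split.
- move=> x t xC t0.
  have nu : {near t, superposition lam phi a b x =1 u x}.
    by apply: near_eq_half_line t0 => s s0; rewrite uE.
  by apply: near_eq_derivable nu _; case: (D0 x t).
- move=> x t xC t0; apply: near_eq_derivable (near_u1 x t xC t0) _.
  by case: (D1 x t).
- move=> x xC; apply/cvg_ex; eexists.
  by apply: right_quotient_cvg (D0 x 0) => s; exact: uE.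
- move=> x xC.
  apply: (@subspace_eq_continuous _ _ _ (superposition lam phi a b x)).
    by move=> t /set_mem/=; rewrite in_itv/= andbT => t0; exact/esym/uE.
  exact/continuous_subspaceT/(is_derive_continuous (D0 x)).
- move=> x xC.
  apply: (@subspace_eq_continuous _ _ _ (superposition lam phi b a' x)).
    by move=> t /set_mem/=; rewrite in_itv/= andbT => t0; exact/esym/tdE.
  exact/continuous_subspaceT/(is_derive_continuous (D1 x)).
- move=> x t xS t0; have xC := vclosure_interior adj xS.
  rewrite derive1nS derive1n1 derive1E -(near_eq_derive _ (near_u1 x t xC t0)).
  rewrite -derive1E (is_derive1_derive1 (D1 x t)).
  rewrite (eq_laplacian (k := superposition lam phi a b ^~ t) _ xS); last first.
    by move=> y yC; rewrite uE// ltW.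
  rewrite laplacian_sum//; apply: eq_bigr => j _.
  rewrite -[laplacian _ _ _]opprK (eigen_eq basis)// /oscillation /a'.
  by ring.
- move=> t t0 x dx; rewrite uE//; last by right.
  by rewrite /superposition big1// => j _; rewrite (eigen_bc basis j dx) mulr0.
- move=> x xS; rewrite uE//; last exact: vclosure_interior.
  rewrite (eigenbasis_expansion lf basis f0 (vclosure_interior adj xS)).
  by apply: eq_bigr => j _; rewrite oscillation0.
- move=> x xS; rewrite tdE//; last exact: vclosure_interior.
  rewrite (eigenbasis_expansion lf basis g0 (vclosure_interior adj xS)).
  by apply: eq_bigr => j _; rewrite oscillation0.
Unshelve. all: by end_near. Qed.

(** Pairing the wave equation with [phi j] gives a scalar oscillator equation.
    The second conjunct gives the coefficients of the velocity, which enter the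
    kinetic part of the energy. *)
Lemma wave_coefficients (R : realType) (V : choiceType)
    (adj : rel V) (S : {fset V}) (n : nat) (lam : 'I_n -> R)
    (phi : 'I_n -> V -> R) (f g : V -> R) (u : V -> R -> R) (j : 'I_n) (t : R) :
  symmetric adj -> locally_finite adj -> 0 < lam j ->
  dirichlet_eigenbasis adj S lam phi ->
  wave_solution adj S f g u -> 0 <= t ->
  let w := Num.sqrt (lam j) in
  let a := vinner adj S f (phi j) in
  let b := vinner adj S g (phi j) in
  vinner adj S (u ^~ t) (phi j) = oscillation w a b t /\
  vinner adj S (fun x => time_deriv (u x) t) (phi j)
    = oscillation w b (- (lam j * a)) t.
Proof.
move=> adjC lf lam0 basis [d1 d2 _ uc udc ueq ubc uf ug] t0 w a b.
pose c r := vinner adj S (u ^~ r) (phi j).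
pose d r := vinner adj S (fun x => time_deriv (u x) r) (phi j).
have phi0 := eigen_bc basis j.
have innerE (h : V -> R -> R) : (fun r => vinner adj S (h ^~ r) (phi j))
    = (fun r => \sum_(x <- closure_fset adj S) h x r * phi j x).
  by apply/funext => r; rewrite vinnerE.
have inner_cont (h : V -> R -> R) : (forall x, vclosure adj S x ->
      {within `[(0 : R), +oo[, continuous (h x)}) ->
    {within `[(0 : R), +oo[,
      continuous (fun r => vinner adj S (h ^~ r) (phi j))}.
  move=> hc; rewrite innerE.
  apply: within_continuous_big_sum => x /(in_closure_fset _ _ lf) xC.
  apply: (@within_continuousM _ (h x) (cst (phi j x))); first exact: hc.
  by apply: continuous_subspaceT => r; exact: cvg_cst.
have c0 : c 0 = a by apply: eq_vinner_vanishing.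
have d0 : d 0 = b by apply: eq_vinner_vanishing.
rewrite -c0 -d0 -[X in - (X * _)](sqr_sqrtr (ltW lam0)).
apply: (oscillator_uniqueness (sqrtr_neq0 lam0) (inner_cont u uc)
  (inner_cont _ udc)) t0 => r r0.
  rewrite innerE vinnerE//.
  apply: is_derive_big_sum => x /(in_closure_fset _ _ lf) xC.
  apply: is_deriveMr; rewrite time_deriv_gt0// derive1E.
  by apply: derivableP; exact: d1.
rewrite sqr_sqrtr ?(ltW lam0)//.
rewrite -(vinner_laplacian_eigen _ adjC lf basis (ubc r (ltW r0))).
rewrite (eq_vinner_vanishing (h' := fun x => (u x)^`(2) r) lf phi0); last first.
  by move=> x xS; rewrite ueq.
rewrite innerE vinnerE//.
apply: is_derive_big_sum => x /(in_closure_fset _ _ lf) xC.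
apply: is_deriveMr; apply: (@near_eq_is_derive _ _ _ (u x)^`()).
  by near=> s; rewrite time_deriv_gt0//; near: s; exact: lt_nbhsr.
by rewrite derive1nS derive1n1 derive1E; apply: derivableP; exact: d2.
Unshelve. all: by end_near. Qed.

(** The velocity has to vanish on the boundary for it to be expanded in the
    eigenbasis. *)
Lemma time_deriv_boundary (R : realType) (V : choiceType)
    (adj : rel V) (S : {fset V}) (f g : V -> R) (u : V -> R -> R) (t : R) :
  wave_solution adj S f g u -> 0 <= t ->
  vanishes_on_boundary adj S (fun x => time_deriv (u x) t).
Proof.
move=> sol t0 x dx; apply: (time_deriv_eq (k := cst 0)) t0.
by move=> s s0; rewrite (wave_bc sol s0 dx).
Qed.

Theorem theorem2 (R : realType) (V : choiceType) (adj : rel V)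
    (adj_sym : symmetric adj) (adj_irr : irreflexive adj)
    (adj_lf : locally_finite adj)
    (S : {fset V}) (S_conn : induced_connected adj S)
    (dS_neq0 : boundary adj S !=set0)
    (n : nat) (lam : 'I_n -> R) (phi : 'I_n -> V -> R)
    (lam_phi : dirichlet_eigenbasis adj S lam phi)
    (f g : V -> R)
    (f_bc : vanishes_on_boundary adj S f)
    (g_bc : vanishes_on_boundary adj S g) :
  (forall u : V -> R -> R,
     wave_solution adj S f g u <->
     (forall x t, vclosure adj S x -> 0 <= t ->
        u x t = \sum_(j < n)
          (vinner adj S f (phi j) * cos (Num.sqrt (lam j) * t)
           + vinner adj S g (phi j) *
             (sin (Num.sqrt (lam j) * t) / Num.sqrt (lam j))) * phi j x)) /\
  (forall u : V -> R -> R, wave_solution adj S f g u ->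
     forall t, 0 <= t ->
       dirichlet_energy adj S (u ^~ t)
         + \sum_(x \in vclosure adj S) time_deriv (u x) t ^+ 2
       = dirichlet_energy adj S f + \sum_(x \in vclosure adj S) g x ^+ 2).
Proof.
have lam0 j := eigenvalue_gt0 j adj_sym adj_lf S_conn dS_neq0 lam_phi.
split=> u.
  split; last exact: superposition_wave_solution.
  move=> sol x t xC t0.
  rewrite (eigenbasis_expansion adj_lf lam_phi (wave_bc sol t0) xC).
  apply: eq_bigr => j _.
  by have [-> _] := wave_coefficients adj_sym adj_lf (lam0 j) lam_phi sol t0.
move=> sol t t0.
rewrite !(dirichlet_energy_spectral adj_sym adj_lf lam_phi)//; last first.
  exact: wave_bc sol _ t0.
rewrite !(parseval adj_lf lam_phi)//; last exact: time_deriv_boundary sol t0.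
rewrite -!big_split /=; apply: eq_bigr => j _.
have [-> ->] := wave_coefficients adj_sym adj_lf (lam0 j) lam_phi sol t0.
have := oscillation_energy (vinner adj S f (phi j)) (vinner adj S g (phi j)) t
  (sqrtr_neq0 (lam0 j)).
by rewrite (sqr_sqrtr (ltW (lam0 j))).
Qed.
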